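(* Let $d\ge 1$ be an integer, $a>0$, $\lambda>0$ and $0<\epsilon<a/4$. Let $\omega$ be a Poisson point process on the torus $\mathbb{T}_a^d$ with intensity measure $\lambda\,dx$, and let $\chi$ be the Euler characteristic of the Čech complex $\mathcal{C}_\epsilon(\omega)$. Then $$\mathbf{E}[\chi]=-\left(\frac{a}{2\epsilon}\right)^d e^{-\lambda(2\epsilon)^d}\,B_d\bigl(-\lambda(2\epsilon)^d\bigr),$$ where $B_d$ is the $d$-th Bell polynomial.
   Context: $\mathbb{T}_a^d=\mathbb{R}^d/a\mathbb{Z}^d$, identified with $X=[0,a)^d$, is equipped with Lebesgue measure and the distance $\rho_d(x,y)=\inf_{m\in\mathbb{Z}^d}\|x-y+ma\|_\infty$. For a finite set $\omega\subset\mathbb{T}_a^d$, the Čech complex $\mathcal{C}_\epsilon(\omega)$ is the abstract simplicial complex with vertex set $\omega$ in which distinct points $v_0,\dots,v_k\in\omega$ form a $k$-simplex if and only if $\bigcap_{i=0}^k B(v_i,\epsilon)\neq\emptyset$, where $B(v,\epsilon)=\{y:\rho_d(v,y)<\epsilon\}$. The Euler characteristic is $\chi(\omega)=\sum_{i\ge 0}(-1)^i s_i(\omega)$, where $s_i(\omega)$ is the number of $i$-simplices (equivalently, the alternating sum of the Betti numbers). A Poisson point process with intensity measure $\lambda\,dx$ is a random finite set $\omega$ such that the number of points in any Borel set $A$ is Poisson with mean $\lambda|A|$, with independence over disjoint sets. Bell polynomials: $B_n(x)=\sum_{k=0}^n \left\{{n\atop k}\right\}x^k$, with $\left\{{n\atop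 k}\right\}$ the Stirling numbers of the second kind. *)

(* Defs.v *)
From mathcomp Require Import all_boot all_order all_algebra finmap.
From mathcomp Require Import all_classical all_reals all_analysis.

Set Implicit Arguments.
Unset Strict Implicit.
Unset Printing Implicit Defensive.

Import Order.TTheory GRing.Theory Num.Theory.
Import numFieldNormedType.Exports.

Local Open Scope classical_set_scope.
Local Open Scope ring_scope.

Section torus.
Context {R : realType}.

(* The Borel sets of R^d are the sets measurable for the product
   sigma-algebra carried by tuples of [measurableTypeR R]. *)
Definition euclid (d : nat) := d.-tuple (measurableTypeR R).

(* d-dimensional Lebesgue measure, one coordinate at a time:
   |A| = \int |{y : (x, y) \in A}| dx, with R^0 of measure 1. *)
Fixpoint lebesgue (d : nat) : set (euclid d) -> \bar R :=
  match d with
  | 0%N => fun A => \d_([tuple] : euclid 0) A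
  | d'.+1 => fun A =>
      (\int[lebesgue_measure]_x
         lebesgue [set y : euclid d' | A [tuple of x :: y]])%E
  end.

(* The fundamental domain [0, a)^d. *)
Definition torus (a : R) (d : nat) : set (euclid d) :=
  [set x | forall i : 'I_d, 0 <= (tnth x i : R) < a].

(* [ `| _ | ] on row vectors is the sup norm. *)
Definition torus_dist (a : R) (d : nat) (x y : euclid d) : R :=
  inf [set `| \row_(i < d) ((tnth x i : R) - tnth y i + (m i)%:~R * a) |
      | m in [set: 'I_d -> int]].

Definition torus_ball (a : R) (d : nat) (v : euclid d) (eps : R) :
    set (euclid d) :=
  [set y : euclid d | torus a y /\ torus_dist a v y < eps].

End torus.
Arguments euclid : clear implicits.
Arguments torus {R} a {d}.

Section cech.
Context {R : realType}.
Local Open Scope fset_scope.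

(* The simplices of the complex, each given by its set of vertices. *)
Definition cech (a eps : R) (d : nat) (omega : {fset euclid R d}) :
    {fset {fset euclid R d}} :=
  [fset s in fpowerset omega | (s != fset0) &&
     `[< \bigcap_(v in [set` s]) torus_ball a v eps !=set0 >]].

Definition num_simplices (a eps : R) (d : nat) (omega : {fset euclid R d})
    (i : nat) : nat :=
  #|` [fset s in cech a eps omega | #|` s| == i.+1]|.

(* There are no i-simplices for i >= #|` omega|. *)
Definition euler_char (a eps : R) (d : nat) (omega : {fset euclid R d}) : int :=
  \sum_(i < #|` omega|) (-1) ^+ i * (num_simplices a eps omega i)%:Z.

End cech.

Section poisson_process.
Context {R : realType} {disp : measure_display} {T : measurableType disp}.

Definition num_points (d : nat) (A : set (euclid R d))
    (omega : {fset euclid R d}) : nat :=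
  #|` [fset x in omega | x \in A]%fset|.

(* Mutual independence; the product rule over a subfamily is the case
   B i = setT for the other indices. *)
Definition mutually_independent (P : probability T R) (n : nat)
    (N : 'I_n -> T -> nat) : Prop :=
  forall B : 'I_n -> set nat,
    (P (\bigcap_(i in [set: 'I_n]) (N i @^-1` B i)) =
     \prod_(i < n) P (N i @^-1` B i))%E.

(* [poisson_prob r k] is the Poisson distribution of mean r (the point mass at
   0 if r = 0); its argument k is not used. *)
Record poisson_process (P : probability T R) (a lambda : R) (d : nat)
    (omega : T -> {fset euclid R d}) : Prop := PoissonProcess {
  poisson_process_torus : forall t x, x \in omega t -> torus a x;
  poisson_process_measurable : forall A : set (euclid R d),
    measurable A -> A `<=` torus a ->
    measurable_fun [set: T] (fun t => num_points A (omega t));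
  poisson_process_law : forall A : set (euclid R d),
    measurable A -> A `<=` torus a ->
    forall B : set nat,
      P [set t | B (num_points A (omega t))] =
      poisson_prob (lambda * fine (lebesgue A)) 0%N B;
  poisson_process_indep : forall (n : nat) (A : 'I_n -> set (euclid R d)),
    (forall i, measurable (A i)) -> (forall i, A i `<=` torus a) ->
    trivIset [set: 'I_n] A ->
    mutually_independent P (fun i t => num_points (A i) (omega t))
}.

End poisson_process.

(* The number of partitions of an n-element set into k nonempty blocks. *)
Definition stirling2 (n k : nat) : nat :=
  #|[set Q : {set {set 'I_n}} | finset.partition Q [set: 'I_n] & #|Q| == k]|.

Definition bell_poly (R : nzRingType) (n : nat) (x : R) : R :=
  \sum_(k < n.+1) (stirling2 n k)%:R * x ^+ k.

(* Main.v *)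
(* Fix a finite configuration omega and the grid of step h = a/N on the circle
   R/aZ. As eps < a/4, the grid points within eps of all points of a nonempty
   set S form an interval of the cyclic grid, so the number of such points minus
   the number of such pairs of consecutive points is 1 or 0, according as there
   is such a point. Multiplying over the d coordinates writes the indicator that
   the balls around S meet in a grid point as a signed sum of indicators
   "S is contained in W", where W ranges over boxes with sides 2 eps or
   2 eps - h. By inclusion-exclusion, summing over the simplices S turns these
   into the indicators "W meets omega". For large N the result is the Euler
   characteristic, so only the void probabilities exp(-lambda |W|) enter the
   expectation. It is minus the d-fold mixed difference quotient of
   exp(-lambda u_1...u_d), times a^d, between 2 eps - h and 2 eps. As h -> 0
   this becomes a mixed derivative, i.e. (t d/dt)^d exp(-lambda t) / t at
   t = (2 eps)^d, and (t d/dt)^d exp(-lambda t) = B_d(-lambda t) exp(-lambda t).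
   The limit is exchanged with the expectation by domination by 2^|omega|. *)

Require Import Defs.
From HB Require Import structures.
From mathcomp Require Import all_boot all_order all_algebra finmap.
From mathcomp Require Import all_classical all_reals all_analysis.
From mathcomp Require Import measurable_realfun ring lra zify.

Set Implicit Arguments.
Unset Strict Implicit.
Unset Printing Implicit Defensive.

Import Order.TTheory GRing.Theory Num.Theory.
Import numFieldNormedType.Exports.

Local Open Scope classical_set_scope.
Local Open Scope ring_scope.

(** * Stirling numbers and Bell polynomials *)

Section bell.
Local Open Scope nat_scope.

Lemma pblockT_mem (I : finType) (Q : {set {set I}}) (i : I) :
  finset.partition Q [set: I] -> finset.pblock Q i \in Q.
Proof. by move=> /and3P[/eqP cQ _ _]; rewrite pblock_mem // cQ finset.in_setT. Qed.

Lemma leq_card_partitionT (I : finType) (Q : {set {set I}}) :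
  finset.partition Q [set: I] -> #|Q| <= #|I|.
Proof.
move=> pQ; have [/eqP cQ tQ Q0] := and3P pQ.
suff -> : Q = [set finset.pblock Q i | i in [set: I]]%SET.
  by rewrite (leq_trans (leq_imset_card _ _)) // cardsT.
apply/finset.setP => B; apply/idP/imsetP => [BQ|[i _ ->]].
  have [B0|[i iB]] := finset.set_0Vmem B.
    by move: BQ; rewrite B0 (negbTE Q0).
  by exists i => //; rewrite (def_pblock tQ BQ iB).
exact: pblockT_mem.
Qed.

(** The functions with kernel [Q] are the injections from the blocks of [Q] into [T], composed with
    the map sending a point to its block. *)
Lemma card_preim_partition (I T : finType) (Q : {set {set I}}) :
  finset.partition Q [set: I] ->
  #|[set f : {ffun I -> T} | preim_partition f [set: I] == Q]%SET| = #|T| ^_ #|Q|.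
Proof.
move=> pQ; have [/eqP cQ tQ Q0] := and3P pQ.
have inQ i : i \in finset.pblock Q i by rewrite mem_pblock cQ finset.in_setT.
pose B i : {B | B \in Q} := exist _ (finset.pblock Q i) (pblockT_mem i pQ).
pose h (g : {ffun {B | B \in Q} -> T}) := [ffun i => g (B i)].
have surjB (b : {B | B \in Q}) : exists i, B i = b.
  case: b => b bQ; have [b0|[i ib]] := finset.set_0Vmem b.
    by exfalso; move: bQ; rewrite b0 (negbTE Q0).
  by exists i; apply: val_inj; exact: def_pblock.
have hinj : injective h.
  move=> g g' /ffunP gg'; apply/ffunP => b; have [i <-] := surjB b.
  by have := gg' i; rewrite !ffunE.
have eqB i j : (B i == B j) = (j \in finset.pblock Q i).
  by rewrite -(eq_pblock _ tQ) ?cQ ?finset.in_setT.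
suff <- : [set h g | g in [set g : {ffun {B | B \in Q} -> T} | injectiveb g]]%SET =
    [set f : {ffun I -> T} | preim_partition f [set: I] == Q]%SET.
  by rewrite card_imset // card_inj_ffuns card_sig.
apply/finset.setP => f; rewrite inE; apply/imsetP/eqP => [[g]|fQ].
  rewrite inE => /injectiveP ginj ->.
  rewrite -[RHS](equivalence_partition_pblock pQ).
  apply: eq_imset => i; apply/finset.setP => j.
  by rewrite !inE !ffunE (inj_eq ginj) eqB.
have fE i j : (f i == f j) = (B i == B j).
  rewrite eqB -fQ pblock_equivalence_partition ?finset.in_setT //.
  by split=> // /eqP ->.
have [r rK] := fin_all_exists surjB.
exists [ffun b => f (r b)].
  rewrite inE; apply/injectiveP => b c; rewrite !ffunE => /eqP.
  by rewrite fE !rK => /eqP.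
by apply/ffunP => i; rewrite !ffunE; apply/eqP; rewrite fE rK.
Qed.

(** Sort the functions from ['I_n] to ['I_m] by their kernel, then by its number of blocks. *)
Lemma expn_stirling2 (n m : nat) :
  m ^ n = \sum_(k < n.+1) stirling2 n k * m ^_ k.
Proof.
have := card_ffun 'I_n 'I_m; rewrite !card_ord => <-.
rewrite -sum1_card.
rewrite (partition_big (fun f : {ffun 'I_n -> 'I_m} =>
  preim_partition f [set: 'I_n])
  (fun Q => finset.partition Q [set: 'I_n])) /=; last first.
  by move=> f _; exact: preim_partitionP.
rewrite (partition_big (fun Q : {set {set 'I_n}} => inord #|Q| : 'I_n.+1) predT) //=.
apply: eq_bigr => k _.
rewrite /stirling2 -sum1_card big_distrl /=.
have cardQ (Q : {set {set 'I_n}}) : finset.partition Q [set: 'I_n] -> #|Q| < n.+1.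
  by move=> /leq_card_partitionT; rewrite card_ord ltnS.
apply: eq_big => [Q|Q /andP[pQ /eqP <-]].
  rewrite inE; have [pQ|//] := boolP (finset.partition _ _) => /=.
  by rewrite -val_eqE /= inordK // cardQ.
rewrite inordK ?cardQ // mul1n -[m in RHS]card_ord -card_preim_partition //.
by rewrite sum1dep_card; apply: eq_card => f; rewrite !inE.
Qed.

(** The system is triangular: at [m = k] the terms of index above [k] vanish and the [k]-th one has
    a nonzero factorial as coefficient. *)
Lemma ffact_basis_inj (d : nat) (s t : nat -> nat) :
  (forall m, \sum_(k < d) s k * m ^_ k = \sum_(k < d) t k * m ^_ k) ->
  forall k, k < d -> s k = t k.
Proof.
move=> st k; elim/ltn_ind: k => k IH kd.
have E (u : nat -> nat) : \sum_(i < d) u i * k ^_ i =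
    \sum_(i < k) u i * k ^_ i + u k * k`!.
  rewrite -(big_mkord xpredT (fun i => u i * k ^_ i)).
  rewrite (big_cat_nat (n := k.+1)) //= big_nat_recr //= ffactnn.
  rewrite big_mkord [X in _ + X = _]big_nat_cond [X in _ + X = _]big1 ?addn0 // => i.
  by rewrite andbT => /andP[ki _]; rewrite ffact_small ?muln0.
have := st k; rewrite !E.
rewrite (eq_bigr (fun i : 'I_k => t i * k ^_ i)); last first.
  by move=> i _; rewrite IH // (ltn_trans _ kd).
by move/addnI/eqP; rewrite eqn_pmul2r ?fact_gt0 // => /eqP.
Qed.

Lemma stirling2_gt (n k : nat) : n < k -> stirling2 n k = 0.
Proof.
move=> nk; apply/eqP; rewrite /stirling2 cards_eq0; apply/eqP/finset.setP => Q.
rewrite !inE; apply/negP => /andP[/leq_card_partitionT + /eqP Qk].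
by rewrite Qk card_ord leqNgt nk.
Qed.

(* Compare [m ^ n.+1] and [m * m ^ n] in the basis of falling factorials,
   where [m * m ^_ k = m ^_ k.+1 + k * m ^_ k]. *)
Lemma stirling2S (n k : nat) :
  stirling2 n.+1 k = k * stirling2 n k + (0 < k) * stirling2 n k.-1.
Proof.
have [kn|nk] := ltnP k n.+2; last first.
  by rewrite !stirling2_gt ?muln0 //; lia.
apply: (@ffact_basis_inj n.+2 (stirling2 n.+1)
  (fun k => k * stirling2 n k + (0 < k) * stirling2 n k.-1)) => // m.
rewrite -expn_stirling2 expnS expn_stirling2 big_distrr /=.
transitivity (\sum_(i < n.+2) i * stirling2 n i * m ^_ i +
    \sum_(i < n.+2) (0 < i) * stirling2 n i.-1 * m ^_ i); last first.
  by rewrite -big_split; apply: eq_bigr => i _ /=; rewrite mulnDl.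
rewrite [X in _ = X + _]big_ord_recr /= (stirling2_gt (ltnSn n)) muln0 mul0n addn0.
rewrite [X in _ = _ + X]big_ord_recl /= mul0n add0n -big_split /=.
apply: eq_bigr => i _; rewrite /= mul1n ffactnSr.
have [im|mi] := leqP i m; first by rewrite -{1}(subnKC im); ring.
by rewrite !ffact_small ?muln0 // ltnW.
Qed.
End bell.

(** * Mixed differences *)

Section mixed_difference.
Context {R : realType}.

Lemma sum_ffun_recl (V : nmodType) (X : finType) (n : nat)
    (F : {ffun 'I_n.+1 -> X} -> V) :
  \sum_f F f = \sum_(x : X) \sum_(g : {ffun 'I_n -> X})
    F [ffun i => if unlift ord0 i is Some j then g j else x].
Proof.
rewrite pair_bigA /= (reindex (fun p : X * {ffun 'I_n -> X} =>
  [ffun i => if unlift ord0 i is Some j then p.2 j else p.1])) //=.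
exists (fun f : {ffun 'I_n.+1 -> X} => (f ord0, [ffun j => f (lift ord0 j)])).
  move=> [x g] _ /=; rewrite ffunE unlift_none; congr pair.
  by apply/ffunP => j; rewrite !ffunE liftK.
by move=> f _; apply/ffunP => i; rewrite ffunE /=; case: unliftP => [j|] -> //=;
  rewrite ffunE.
Qed.

(** The iterated operator sums over one coordinate. With signs for [c] and lengths for [w] it
    becomes a difference operator. *)
Lemma sum_ffun_prod_iter (X : finType) (c w : X -> R) (phi : R -> R) (n : nat)
    (t : R) :
  \sum_(f : {ffun 'I_n -> X}) (\prod_i c (f i)) * phi (t * \prod_i w (f i)) =
  iter n (fun psi s => \sum_x c x * psi (s * w x)) phi t.
Proof.
elim: n t => [|n IH] t.
  rewrite (big_pred1 (ffun0 (card_ord 0))) /=.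
    by rewrite !big_ord0 mul1r mulr1.
  by move=> f; apply/esym/eqP/ffunP; case.
rewrite sum_ffun_recl iterS; apply: eq_bigr => x _; rewrite -IH mulr_sumr.
apply: eq_bigr => g _; rewrite !big_ord_recl !ffunE unlift_none !mulrA.
congr (_ * _ * phi (_ * _)); apply: eq_bigr => i _; by rewrite ffunE liftK.
Qed.

(* The [d]-fold mixed difference quotient of [u_1,..,u_d |-> psi 0 (u_1...u_d)]
   between [v] and [u] is a mixed derivative at an intermediate point; here
   [psi k] is the [k]-th iterate of [t d/dt] on [psi 0]. *)
Lemma mixed_difference_MVT (d : nat) (psi : nat -> R -> R) (c u v : R) :
  0 < v < u ->
  (forall k (t : R), 0 < t -> is_derive t 1 (psi k) (psi k.+1 t / t)) ->
  forall t : R, 0 < t -> exists2 p, v ^+ d <= p <= u ^+ d &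
    iter d (fun phi s => c * (phi (s * u) - phi (s * v))) (psi 0%N) t =
    (c * (u - v)) ^+ d * psi d (t * p) / p.
Proof.
move=> /andP[v0 vu] + t t0; elim: d psi => [|d IH] psi dpsi.
  by exists 1; rewrite ?expr0 ?lexx //= mul1r mulr1 divr1.
have u0 : 0 < u by exact: lt_trans vu.
have dscale k (s w : R) : 0 < s -> 0 < w ->
    is_derive s 1 (fun s => psi k (s * w)) (psi k.+1 (s * w) / s).
  move=> s0 w0; have sw0 : 0 < s * w by rewrite mulr_gt0.
  have dm : is_derive s 1 ( *%R^~ w) w.
    rewrite (_ : *%R^~ w = w \*: id); last by apply/funext => r; rewrite mulrC.
    by apply: is_derive_eq; rewrite /GRing.scale /= mulr1.
  rewrite (_ : _ / s = psi k.+1 (s * w) / (s * w) * w).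
    exact: (@is_derive1_comp _ (psi k) ( *%R^~ w) s _ _ (dpsi k _ sw0) dm).
  by field; rewrite !gt_eqF.
(* Peel off the innermost difference. Since [t d/dt] commutes with dilations, [chi] is again a chain
   of iterates; the induction hypothesis then leaves a single difference of [psi d]. *)
pose chi k s := c * (psi k (s * u) - psi k (s * v)).
have dchi k (s : R) : 0 < s -> is_derive s 1 (chi k) (chi k.+1 s / s).
  move=> s0; have d1 := dscale k s u s0 u0; have d2 := dscale k s v s0 v0.
  rewrite (_ : chi k = c \*: ((fun s => psi k (s * u)) - (fun s => psi k (s * v)))) //.
  apply: is_derive_eq; rewrite /chi /GRing.scale /=; field; by rewrite gt_eqF.
have [p /andP[vp pu] E] := IH _ dchi.
set Q := iter _ _ _ _.
have QE : Q = (c * (u - v)) ^+ d * chi d (t * p) / p by rewrite /Q iterSr -E.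
have p0 : 0 < p by rewrite (lt_le_trans _ vp) // exprn_gt0.
have tp0 : 0 < t * p by rewrite mulr_gt0.
have [|||x] := MVT (f := psi d) (df := fun x => psi d.+1 x / x)
    (a := t * p * v) (b := t * p * u).
- by rewrite ltr_pM2l.
- move=> x; rewrite in_itv /= => /andP[x0 _]; apply: dpsi.
  by rewrite (lt_trans _ x0) // mulr_gt0.
- apply: derivable_within_continuous => x; rewrite in_itv /= => /andP[x0 _].
  have x0' : 0 < x by rewrite (lt_le_trans _ x0) // mulr_gt0.
  by have [] := dpsi d _ x0'.
rewrite in_itv /= => /andP[xv xu] Ex.
have x0 : 0 < x by rewrite (lt_trans _ xv) // mulr_gt0.
have E' : t * (x / t) = x by field; rewrite gt_eqF.
exists (x / t).
  rewrite ler_pdivlMr // ler_pdivrMr // !exprS; apply/andP; split.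
    rewrite (le_trans _ (ltW xv)) // mulrAC mulrC -mulrA [v * _]mulrC.
    by rewrite [t * _]mulrCA ler_pM2r ?mulr_gt0.
  rewrite (le_trans (ltW xu)) // [t * p * u]mulrC [t * p]mulrC mulrA.
  by rewrite ler_pM2r // ler_pM2l.
rewrite QE E' /chi Ex exprSr; field.
by rewrite !gt_eqF.
Qed.

End mixed_difference.

(** * Bell polynomials and iterates of [t d/dt] *)

Section bell_derivative.
Context {R : realType}.

Let bellp (n : nat) : {poly R} := \poly_(k < n.+1) (stirling2 n k)%:R.

Let bell_polyE n x : bell_poly n x = (bellp n).[x].
Proof. by rewrite horner_poly. Qed.

Let coef_bellp n k : (bellp n)`_k = (stirling2 n k)%:R.
Proof. by rewrite coef_poly; case: ltnP => // nk; rewrite stirling2_gt. Qed.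

Let bellpS n : bellp n.+1 = 'X * (bellp n + (bellp n)^`()).
Proof.
apply/polyP => k; rewrite coefXM coefD coef_deriv !coef_bellp stirling2S.
case: k => [|k] /=; first by rewrite mul0n.
by rewrite mul1n natrD natrM addrC mulr_natl.
Qed.

Lemma bell_poly0 (x : R) : bell_poly 0 x = 1.
Proof.
rewrite /bell_poly big_ord1 expr0 mulr1.
have := expn_stirling2 0 1; rewrite big_ord1 /= muln1 => <-.
by rewrite expn0.
Qed.

(** By [bellpS] the next Bell polynomial is [x (B_k + B_k')], which is what the product and chain
    rules yield at [x = - (lambda * t)], up to the factor [1 / t]. *)
Lemma is_derive_bell_exp (lambda : R) (k : nat) (t : R) : 0 < t ->
  is_derive t 1 (fun s => bell_poly k (- (lambda * s)) * expR (- (lambda * s)))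
    (bell_poly k.+1 (- (lambda * t)) * expR (- (lambda * t)) / t).
Proof.
move=> t0.
have dl : is_derive t 1 (fun s : R => - (lambda * s)) (- lambda).
  rewrite (_ : (fun s => _) = (- lambda) \*: id); last first.
    by apply/funext => s; rewrite /= -mulNr.
  by apply: is_derive_eq; rewrite /GRing.scale /= mulr1.
have d1 : is_derive t 1 (fun s => (bellp k).[- (lambda * s)])
    ((bellp k)^`().[- (lambda * t)] * (- lambda)).
  exact: (@is_derive1_comp _ (horner (bellp k)) (fun s => - (lambda * s))).
have d2 : is_derive t 1 (fun s => expR (- (lambda * s)))
    (expR (- (lambda * t)) * (- lambda)).
  exact: (@is_derive1_comp _ expR (fun s => - (lambda * s))).
rewrite (_ : (fun s => _) = (fun s => (bellp k).[- (lambda * s)]) *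
  (fun s => expR (- (lambda * s)))); last first.
  by apply/funext => s; rewrite bell_polyE.
apply: is_derive_eq; rewrite bell_polyE bellpS !hornerE /=.
rewrite /GRing.scale /=; field.
by rewrite gt_eqF.
Qed.
End bell_derivative.

(** * Discrete arcs on the circle *)

Section circle.
Context {R : realType}.
Implicit Types (a eps h x y : R) (k z m : int) (N : nat) (S : set R).

(** One coordinate of the torus distance, for arbitrary real representatives, so that grid points
    can be indexed by all integers. *)
Definition circle_near a eps x y : bool :=
  `[< exists m : int, `|x - y + m%:~R * a| < eps >].

Lemma int_lt1_eq0 m a : 0 < a -> - a < m%:~R * a < a -> m = 0.
Proof.
move=> a0 /andP[ma ma']; have : (-1 < m) by rewrite -(ltr_int R) -(ltr_pM2r a0) mulN1r.
have : m < 1 by rewrite -(ltr_int R) -(ltr_pM2r a0) mul1r.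
lia.
Qed.

Lemma circle_near_periodic a eps x y m :
  circle_near a eps x (y + m%:~R * a) = circle_near a eps x y.
Proof.
apply/asboolP/asboolP => -[n xy].
  by exists (n - m); rewrite intrD intrN; congr (`| _ | < _): xy; ring.
by exists (n + m); rewrite intrD; congr (`| _ | < _): xy; ring.
Qed.

Section discrete_arc.
Variables (a eps h : R) (N : nat) (S : set R) (s0 : R).
Hypotheses (a0 : 0 < a) (eps0 : 0 < eps) (epsa : eps < a / 4).
Hypotheses (N0 : (0 < N)%N) (hN : N%:R * h = a) (h_eps : h < 2 * eps) (Ss0 : S s0).

Let Pz z : bool := `[< forall s, S s -> circle_near a eps s (z%:~R * h) >].

Let h0 : 0 < h. Proof. by rewrite -(@pmulr_rgt0 _ N%:R) ?hN ?ltr0n. Qed.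

Let Pz_periodic z m : Pz (z + m * N%:Z) = Pz z.
Proof.
have E s : circle_near a eps s ((z + m * N%:Z)%:~R * h) =
    circle_near a eps s (z%:~R * h).
  rewrite -[RHS](circle_near_periodic _ _ _ _ m); congr circle_near.
  by rewrite intrD intrM -pmulrn mulrDl -mulrA hN.
by apply/asboolP/asboolP => H s Ss; [rewrite -E|rewrite E]; exact: H.
Qed.

(** Up to the period, an admissible index has its point within [eps] of [s0] on the real line, where
    order is available. *)
Let lift z : Pz z ->
  exists m, Pz (z + m * N%:Z) /\ `|s0 - (z + m * N%:Z)%:~R * h| < eps.
Proof.
move=> Pz1; have /asboolP/(_ _ Ss0)/asboolP[m Hm] := Pz1.
exists (- m); split; first by rewrite Pz_periodic.
rewrite intrD intrM intrN -pmulrn mulrDl mulNr mulNr -mulrA hN.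
by congr (`| _ | < _): Hm; ring.
Qed.

(** The shifts bringing a point of [S] near the two ends differ by less than [4 * eps / a < 1],
    hence coincide; closeness on the line then passes to every point in between. *)
Let convex z1 z2 z : Pz z1 -> Pz z2 ->
  `|s0 - z1%:~R * h| < eps -> `|s0 - z2%:~R * h| < eps ->
  (z1 <= z <= z2) -> Pz z.
Proof.
move=> /asboolP P1 /asboolP P2 /ltr_normlP [s1 s1'] /ltr_normlP[s2 s2'] /andP[z1z zz2].
have {}z1z : z1%:~R * h <= z%:~R * h by rewrite ler_pM2r // ler_int.
have {}zz2 : z%:~R * h <= z2%:~R * h by rewrite ler_pM2r // ler_int.
apply/asboolP => s Ss; apply/asboolP.
have /asboolP[m1 /ltr_normlP[q1 q1']] := P1 _ Ss.
have /asboolP[m2 /ltr_normlP[q2 q2']] := P2 _ Ss.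
have m12 : m1 - m2 = 0.
  apply: (int_lt1_eq0 a0); rewrite intrD intrN mulrDl mulNr.
  by have ? := epsa; apply/andP; split; lra.
have {}m12 : m1 = m2 by apply/eqP; rewrite -subr_eq0 m12.
exists m1; rewrite -m12 in q2 q2'; apply/ltr_normlP; split; lra.
Qed.

(** Start near [s0] and keep stepping by [h < 2 * eps]. No step can reach another lift of the arc
    around [s0], so the points stay within [eps] of [s0]; yet [N] steps cover the length [a]. *)
Let no_end_false z : Pz z -> (forall z, Pz z -> Pz (z + 1)) -> False.
Proof.
move=> /lift[m []]; set z0 := z + _ => Pz0 s0z PS.
have step (j : nat) : Pz (z0 + j%:Z) /\ `|s0 - (z0 + j%:Z)%:~R * h| < eps.
  elim: j => [|j [IHP /ltr_normlP[j1 j2]]]; first by rewrite addr0.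
  have PSj : Pz (z0 + j.+1%:Z) by rewrite -addn1 PoszD addrA PS.
  split=> //; have /asboolP/(_ _ Ss0)/asboolP[n Hn] := PSj.
  have E : (z0 + j.+1%:Z)%:~R * h = (z0 + j%:Z)%:~R * h + h.
    by rewrite -addn1 PoszD addrA [in LHS]intrD mulrDl mul1r.
  rewrite E in Hn *; have /ltr_normlP[n1 n2] := Hn.
  have n0 : n = 0.
    have ? := h_eps; have ? := epsa; have ? := eps0; have ? := h0.
    by apply: (int_lt1_eq0 a0); apply/andP; split; lra.
  by move: Hn; rewrite n0 mul0r addr0.
have [_] := step N; have := s0z.
rewrite intrD mulrDl -pmulrn hN => /ltr_normlP[? ?] /ltr_normlP[? ?].
have ? := epsa; have ? := a0; lra.
Qed.

(** Lift both ends near [s0]; if they differed, the successor of the smaller would be admissible by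
    [convex]. *)
Let right_end_unique z1 z2 : Pz z1 -> ~~ Pz (z1 + 1) -> Pz z2 -> ~~ Pz (z2 + 1) ->
  exists m, z1 = z2 + m * N%:Z.
Proof.
move=> /[dup] /lift[m1 [P1 n1]] _ + /lift[m2 [P2 n2]].
rewrite -(Pz_periodic _ m1) -[in X in _ -> X -> _](Pz_periodic _ m2).
rewrite addrAC [in X in _ -> X -> _]addrAC.
move=> E1 E2.
have [z12|z21|z12] := ltgtP (z1 + m1 * N%:Z) (z2 + m2 * N%:Z).
- by case/negP: E1; apply: (convex P1 P2) => //; apply/andP; split; lia.
- by case/negP: E2; apply: (convex P2 P1) => //; apply/andP; split; lia.
by exists (m2 - m1); lia.
Qed.

(** If some index is admissible, [no_end_false] provides a right end and [right_end_unique] excludes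
    a second one modulo [N]. *)
Lemma card_right_ends :
  \sum_(k < N) (Pz k%:Z && ~~ Pz k.+1%:Z)%:R =
  [exists k : 'I_N, Pz k%:Z]%:R :> R.
Proof.
have SE (k : nat) : k.+1%:Z = k%:Z + 1 by rewrite -addn1.
have [/existsP[k Pk]|/existsPn nP] := boolP [exists k : 'I_N, Pz k%:Z]; last first.
  by apply: big1 => k _; rewrite (negbTE (nP k)).
have [/existsP[i /andP[Pi Pi1]]|/existsPn nP] :=
    boolP [exists i : 'I_N, Pz i%:Z && ~~ Pz i.+1%:Z]; last first.
  (* A right end at any integer [z] would give one at its remainder modulo [N], which is in the
     tested range. *)
  exfalso; apply: (no_end_false Pk) => z Pz1.
  have N0' : N%:Z != 0 by rewrite eqz_nat -lt0n.
  have zN : `|(z %% N)%Z|%N%:Z = (z %% N)%Z by rewrite gez0_abs // modz_ge0.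
  have kN : (`|(z %% N)%Z| < N)%N by rewrite -ltz_nat zN ltz_pmod.
  have zE : z = (z %% N)%Z + (z %/ N)%Z * N%:Z by rewrite addrC -divz_eq.
  have E0 : Pz z = Pz (z %% N)%Z by rewrite {1}zE Pz_periodic.
  have E1 : Pz (z + 1) = Pz ((z %% N)%Z + 1) by rewrite {1}zE addrAC Pz_periodic.
  have := nP (Ordinal kN); rewrite /= SE zN negb_and negbK -E0 -E1.
  by rewrite Pz1.
rewrite (bigD1 i) //= Pi Pi1 big1 ?addr0 // => j ji.
have [/andP[Pj Pj1]|//] := boolP (_ && _); exfalso.
move: Pi1 Pj1; rewrite !SE => Pi1 Pj1.
have [m ijm] := right_end_unique Pi Pi1 Pj Pj1.
have [iN jN] := (ltn_ord i, ltn_ord j).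
case/negP: ji; rewrite -val_eqE /=.
have [m0|m0|m0] := ltgtP m 0; [nia|nia|].
by move: ijm; rewrite m0 mul0r addr0 => -[->].
Qed.
End discrete_arc.
End circle.

(** * Lengths of arcs and volumes of boxes *)

Section arc_measure.
Context {R : realType}.

(** Translate by a multiple of [a] until the left end lies in [[0, a)]. The arc is then one interval
    or, if it runs past [a], two, the second starting at 0. *)
Lemma arc_measure (a c e : R) : 0 < a -> c <= e -> e - c <= a ->
  let A := [set x : measurableTypeR R |
    0 <= (x : R) < a /\ exists m : int, c < (x : R) + m%:~R * a < e] in
  measurable A /\ lebesgue_measure A = (e - c)%:E.
Proof.
move=> a0 ce eca A; pose q := Num.floor (c / a).
have /andP[qc cq] : q%:~R * a <= c < q%:~R * a + a.
  rewrite -ler_pdivlMr // ge_floor /= -[X in _ + X]mul1r -mulrDl -ltr_pdivrMr //.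
  by rewrite -[1]/(1%:~R) -intrD; exact: lt_succ_floor.
set c0 := c - q%:~R * a; set e0 := e - q%:~R * a.
have AE x : A x <-> (0 <= x < a) /\ (c0 < x < e0 \/ x < e0 - a).
  split=> -[/andP[x0 xa]].
    move=> [m /andP[cx xe]]; rewrite x0 xa; split=> //.
    have mq0 : -1 < m - q.
      rewrite -(ltr_int R) -(ltr_pM2r a0) mulN1r intrD intrN mulrDl mulNr; lra.
    have mq1 : m - q < 2.
      rewrite -(ltr_int R) -(ltr_pM2r a0) intrD intrN mulrDl mulNr; lra.
    have [mq|mq] : m = q \/ m = q + 1 by lia.
      by left; rewrite /c0 /e0 -mq; apply/andP; split; lra.
    right; move: xe; rewrite mq intrD mulrDl mul1r /e0; lra.
  rewrite /A /= x0 xa /c0 /e0 => -[/andP[cx xe]|xe]; split=> //.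
    by exists q; apply/andP; split; lra.
  by exists (q + 1); rewrite intrD mulrDl mul1r; apply/andP; split; lra.
have [e0a|ae0] := leP e0 a.
  have -> : A = [set` `]c0, e0[].
    apply/seteqP; split=> x.
      move=> /AE[/andP[x0 xa] [xce|xe]]; rewrite /= in_itv //=.
      by move: e0a xe x0 => *; exfalso; lra.
    rewrite /= in_itv /= => /andP[cx xe]; apply/AE.
    by split; [apply/andP; split; rewrite /c0 in cx; lra|left; rewrite cx].
  split; first exact: measurable_itv.
  rewrite lebesgue_measure_itv /= lte_fin; case: ltP => [_|ec].
    by rewrite -EFinB /c0 /e0; congr (_%:E); ring.
  congr (_%:E); move: ec; rewrite /c0 /e0; lra.
have -> : A = [set` `]c0, a[] `|` [set` `[0, e0 - a[].
  apply/seteqP; split=> x.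
    move=> /AE[/andP[x0 xa] [/andP[xc xe]|xe]].
      by left; rewrite /= in_itv /= xc xa.
    by right; rewrite /= in_itv /= x0 xe.
  move=> [|]; rewrite /= in_itv /= => /andP[xc xa]; apply/AE.
    split; first by apply/andP; split; rewrite /c0 in xc; lra.
    by left; rewrite xc; lra.
  split; first by apply/andP; split; rewrite /e0 in xa; lra.
  by right.
split; first by apply: measurableU; exact: measurable_itv.
rewrite measureU; [|exact: measurable_itv|exact: measurable_itv|]; last first.
  apply/seteqP; split=> // x [] /=; rewrite !in_itv /= => /andP[cx _] /andP[_ xe].
  rewrite /c0 /e0 in cx xe; lra.
rewrite [X in (X + _)%E]lebesgue_measure_itv.
rewrite [X in (_ + X)%E]lebesgue_measure_itv /= !lte_fin.
have -> : c0 < a by rewrite /c0; lra.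
rewrite subr_gt0 ae0 -!EFinB -EFinD; congr (_%:E); rewrite /c0 /e0; ring.
Qed.

End arc_measure.

Section lebesgue_box.
Context {R : realType}.

Lemma lebesgue_set0 d : lebesgue (set0 : set (euclid R d)) = 0%E.
Proof.
elim: d => [|d IH] /=; first by rewrite diracE in_set0.
by apply: integral0_eq => x _; exact: IH.
Qed.

Lemma measurable_box d (A : 'I_d -> set (measurableTypeR R)) :
  (forall i, measurable (A i)) ->
  measurable [set x : euclid R d | forall i, A i (tnth x i)].
Proof.
move=> mA; have -> : [set x : euclid R d | forall i, A i (tnth x i)] =
    \bigcap_(i in [set: 'I_d]) ((@tnth d _)^~ i @^-1` A i).
  by apply/seteqP; split=> [x xA i _|x xA i]; [exact: xA|exact: (xA i)].
apply: fin_bigcap_measurable => // i _; rewrite -[X in measurable X]setTI.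
exact: measurable_tnth.
Qed.

Lemma lebesgue_box d (A : 'I_d -> set (measurableTypeR R)) (m : 'I_d -> R) :
  (forall i, measurable (A i)) ->
  (forall i, lebesgue_measure (A i) = (m i)%:E) ->
  lebesgue [set x : euclid R d | forall i, A i (tnth x i)] =
  (\prod_(i < d) m i)%:E.
Proof.
elim: d A m => [|d IH] A m mA Am /=.
  rewrite big_ord0 diracE mem_set //; by case.
rewrite big_ord_recl EFinM muleC -Am -integral_cst //.
rewrite [RHS]integral_mkcond; apply: eq_integral => x _.
rewrite patchE -(IH (fun i => A (lift ord0 i))) //.
case: ifPn => [/set_mem Ax|/negP Ax].
  congr lebesgue; apply/seteqP; split=> y H i.
    by have := H (lift ord0 i); rewrite tnthS.
  by case: (unliftP ord0 i) => [j|] ->; rewrite ?tnthS.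
transitivity (lebesgue (set0 : set (euclid R d))); last by rewrite lebesgue_set0.
congr lebesgue; apply/seteqP; split=> y //= H.
by apply: Ax; apply/mem_set; exact: (H ord0).
Qed.

End lebesgue_box.

(** * Arcs around grid points *)

Section grid_arc.
Context {R : realType}.
Implicit Types (a eps : R) (N : nat).

(* The grid on the circle has step [a / N]; [(k, false)] is the arc of radius
   [eps] around the grid point [k], and [(k, true)] its intersection with the
   next one. *)
Definition grid_arc a eps N (p : 'I_N * bool) (x : R) : bool :=
  circle_near a eps x (p.1%:R * (a / N%:R)) &&
  (p.2 ==> circle_near a eps x (p.1.+1%:R * (a / N%:R))).

Definition grid_arc_length a eps N (b : bool) : R :=
  2 * eps - (if b then a / N%:R else 0).

(** For two consecutive arcs the integer shifts differ by less than [4 * eps / a], hence agree; the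
    intersection is a single arc, shortened at its left end by one grid step. *)
Lemma grid_arc_measure a eps N (p : 'I_N * bool) :
  0 < eps -> eps < a / 4 -> a / N%:R < 2 * eps ->
  let A := [set x : measurableTypeR R | 0 <= (x : R) < a /\ grid_arc a eps p x] in
  measurable A /\ lebesgue_measure A = (grid_arc_length a eps N p.2)%:E.
Proof.
move=> eps0 epsa hN; have a0 : 0 < a by lra.
have h0 : 0 <= a / N%:R by rewrite divr_ge0 // ltW.
case: p => -[k kN] b; rewrite /grid_arc /grid_arc_length /=.
have -> : k.+1%:R * (a / N%:R) = k%:R * (a / N%:R) + a / N%:R.
  by rewrite -natr1 mulrDl mul1r.
set h := a / N%:R in hN h0 *; set y := k%:R * h.
have ->: [set x : measurableTypeR R | 0 <= (x : R) < a /\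
      circle_near a eps x y && (b ==> circle_near a eps x (y + h))] =
    [set x : measurableTypeR R | 0 <= (x : R) < a /\
      exists m : int, y + (if b then h else 0) - eps < (x : R) + m%:~R * a < y + eps].
  apply/seteqP; split=> x /= -[-> H]; split=> //.
    case/andP: H => /asboolP[m /ltr_normlP[m1 m2]]; case: b => /=; last first.
      by exists m; apply/andP; split; lra.
    move=> /asboolP[n /ltr_normlP[n1 n2]].
    have mn : m - n = 0.
      by apply: (int_lt1_eq0 a0); rewrite intrD intrN mulrDl mulNr;
        apply/andP; split; lra.
    have {}mn : m = n by apply/eqP; rewrite -subr_eq0 mn.
    by exists m; rewrite -mn in n1 n2; apply/andP; split; lra.
  case: H => m /andP[m1 m2]; apply/andP; split.
    by apply/asboolP; exists m; apply/ltr_normlP; case: b m1 => m1; split; lra.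
  apply/implyP => bT; rewrite bT in m1.
  by apply/asboolP; exists m; apply/ltr_normlP; split; lra.
rewrite (_ : 2 * eps - _ = y + eps - (y + (if b then h else 0) - eps));
  last by case: b; ring.
by apply: arc_measure => //; case: b; lra.
Qed.

(** At a grid point [k] the two signs combine to the indicator that [k] is near all of [S] while
    [k.+1] is not; [card_right_ends] counts these. *)
Lemma sum_grid_arc a eps N (S : set R) : 0 < eps -> eps < a / 4 ->
  (0 < N)%N -> a / N%:R < 2 * eps -> S !=set0 ->
  \sum_(p : 'I_N * bool) (-1) ^+ p.2 * (`[< S `<=` grid_arc a eps p >])%:R =
  [exists k : 'I_N, `[< S `<=` circle_near a eps ^~ (k%:R * (a / N%:R)) >]]%:R :> R.
Proof.
move=> eps0 epsa N0 hN [s0 Ss0]; have a0 : 0 < a by lra.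
have hN' : N%:R * (a / N%:R) = a by rewrite mulrC divfK // pnatr_eq0 -lt0n.
have := card_right_ends a0 eps0 epsa N0 hN' hN Ss0 => /= <-.
rewrite -(pair_bigA _ (fun (k : 'I_N) (b : bool) =>
  (-1) ^+ b * (`[< S `<=` grid_arc a eps (k, b) >])%:R)) /=.
apply: eq_bigr => k _; rewrite big_bool /= expr1 expr0 mul1r mulN1r.
set P := fun k : nat => `[< S `<=` circle_near a eps ^~ (k%:R * (a / N%:R)) >].
have -> : `[< S `<=` grid_arc a eps (k, true) >] = P k && P k.+1.
  apply/asboolP/andP => [H|[/asboolP H /asboolP H'] s Ss].
    by split; apply/asboolP => s /H /andP[].
  by apply/andP; split; [exact: H|exact: H'].
have -> : `[< S `<=` grid_arc a eps (k, false) >] = P k.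
  apply/asboolP/asboolP => H s Ss; first by have /andP[] := H s Ss.
  by rewrite /= /grid_arc andbT; exact: H.
rewrite -/(P k) -/(P k.+1); case: (P k); case: (P k.+1) => /=; ring.
Qed.

Lemma near_circle_near a eps (s y : R) : 0 < a -> circle_near a eps s y ->
  \forall N \near \oo, forall z, `|y - z| <= a / N%:R -> circle_near a eps s z.
Proof.
move=> a0 /asboolP[m Hm]; set r := eps - `|s - y + m%:~R * a|.
have r0 : 0 < r by rewrite subr_gt0.
near=> N => z yz; apply/asboolP; exists m.
have N0 : 0 < N%:R :> R by rewrite ltr0n; near: N; exact: nbhs_infty_gt.
have Nr : a / N%:R < r.
  rewrite ltr_pdivrMr // mulrC -ltr_pdivrMr //; near: N; exact: nbhs_infty_gtr.
rewrite (_ : _ + _ = (s - y + m%:~R * a) + (y - z)); last by ring.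
rewrite (le_lt_trans (ler_normD _ _)) // -ltrBDl.
by rewrite (le_lt_trans yz).
Unshelve. all: by end_near. Qed.

(** Round [y] down to the grid; finiteness of [I] makes one threshold on [N] valid for all [s i]. *)
Lemma near_exists_grid a eps (I : finType) (s : I -> R) (y : R) :
  0 <= y < a -> (forall i, circle_near a eps (s i) y) ->
  \forall N \near \oo,
    exists k : 'I_N, forall i, circle_near a eps (s i) (k%:R * (a / N%:R)).
Proof.
move=> /andP[y0 ya] sy; have a0 : 0 < a by exact: le_lt_trans ya.
near=> N.
have N0 : 0 < N%:R :> R by rewrite ltr0n; near: N; exact: nbhs_infty_gt.
have h0 : 0 < a / N%:R by rewrite divr_gt0.
have yh0 : 0 <= y / (a / N%:R) by rewrite divr_ge0 // ltW.
have /andP[t1 t2] := truncn_itv yh0.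
have kN : (Num.truncn (y / (a / N%:R)) < N)%N.
  rewrite -(ltr_nat R) (le_lt_trans t1) // ltr_pdivrMr //.
  by rewrite mulrC divfK // gt_eqF.
have sN : forall i z, `|y - z| <= a / N%:R -> circle_near a eps (s i) z.
  by near: N; apply: filter_forall => i; exact: near_circle_near.
exists (Ordinal kN) => i /=; apply: sN.
rewrite ler_pdivlMr // in t1; rewrite ltr_pdivrMr // -natr1 mulrDl mul1r in t2.
by rewrite ger0_norm; lra.
Unshelve. all: by end_near. Qed.

End grid_arc.

(** * Alternating sums over simplices *)

Section simplicial_sums.
Context {R : comNzRingType} {K : choiceType}.
Local Open Scope fset_scope.
Implicit Types (F s : {fset K}).

Lemma prod_indicator (I : finType) (b : pred I) :
  \prod_i (b i)%:R = [forall i, b i]%:R :> R.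
Proof.
have [/forallP bi|/forallPn[i /negbTE bi]] := boolP [forall i, b i].
  by apply: big1 => i _; rewrite bi.
by rewrite (bigD1 i) //= bi mul0r.
Qed.

(** Expand the product over [F] of the factors [-1 + 1]. *)
Lemma sum_sign_fpowerset F :
  \sum_(s <- fpowerset F) (-1) ^+ #|` s| = (F == fset0)%:R :> R.
Proof.
rewrite big_imfset /=; last first.
  move=> X Y _ _ XY; apply/finset.setP => x.
  have := congr1 (fun s : {fset K} => val x \in s) XY.
  by rewrite !mem_imfset //; exact: val_inj.
transitivity (\prod_(i : F) (-1 + 1 : R)).
  rewrite bigA_distr big_enum /= powersetT.
  apply: eq_big => [X|X _]; first by rewrite inE.
  rewrite card_imfset; last exact: val_inj.
  by rewrite -big_mkcond prodr_const /= cardE.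
rewrite addNr prodr_const -cardfE -cardfs_eq0 expr0n.
by case: (_ == _).
Qed.

(** The subsets counted are the faces of the full simplex on the points of [F] in [W], whose Euler
    characteristic is 1 unless there are no such points. *)
Lemma sum_sign_simplices F (W : set K) :
  \sum_(s <- fpowerset F | s != fset0)
    (-1) ^+ (#|` s|.-1) * (`[< ([set` s] `<=` W)%classic >])%:R =
  (0 < #|` [fset x in F | x \in W]|)%N%:R :> R.
Proof.
set G := [fset x in F | x \in W].
have GE s : (s \in fpowerset F) && `[< ([set` s] `<=` W)%classic >] =
    (s \in fpowerset G).
  rewrite !fpowersetE; apply/andP/fsubsetP => [[/fsubsetP sF /asboolP sW] x xs|sG].
    by rewrite !inE /= sF // mem_set //; exact: sW.
  split; first by apply/fsubsetP => x /sG; rewrite !inE => /andP[].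
  by apply/asboolP => x /= /sG; rewrite !inE => /andP[_ /set_mem].
under eq_bigr do rewrite mulr_natr mulrb.
rewrite -big_mkcondr /=.
transitivity (\sum_(s <- fpowerset G | s != fset0) - (-1) ^+ #|` s| : R).
  apply: eq_fbig_cond => [s|s _ /andP[+ _]].
    by rewrite !inE /= -GE andbCA [RHS]andbC.
  by rewrite -cardfs_gt0 => s0; rewrite -[in RHS](prednK s0) exprS mulN1r opprK.
have := sum_sign_fpowerset G.
rewrite (big_fsetD1 fset0) ?fpowersetE ?fsub0set // cardfs0 expr0.
rewrite -cardfs_eq0 lt0n /= => E.
rewrite sumrN big_fset_condE.
have -> : [fset s in fpowerset G | s != fset0] = fpowerset G `\ fset0.
  by apply/fsetP => s; rewrite !inE andbC.
have := congr1 (+%R (-1)) E; rewrite addKr => ->.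
by case: (_ == _); rewrite /= ?addNr ?oppr0 // addr0 opprK.
Qed.

Lemma sum_simplices_by_dim (C : {fset {fset K}}) n :
  (forall s, s \in C -> (0 < #|` s| <= n)%N) ->
  \sum_(i < n) (-1) ^+ i * (#|` [fset s in C | #|` s| == i.+1]|)%:R =
  \sum_(s <- C) (-1) ^+ (#|` s|.-1) :> R.
Proof.
move=> Cn.
transitivity (\sum_(i < n) \sum_(s <- C) if #|` s| == i.+1 then (-1) ^+ i else 0 : R).
  apply: eq_bigr => i _; rewrite -big_mkcond card_fset_sum1 big_fset.
  rewrite natr_sum mulr_sumr /=.
  by apply: eq_bigr => s _; rewrite mulr1.
rewrite exchange_big /= big_seq [RHS]big_seq; apply: eq_bigr => s /Cn /andP[s0 sn].
have kn : (#|` s|.-1 < n)%N by rewrite prednK.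
rewrite (bigD1 (Ordinal kn)) //= prednK // eqxx big1 ?addr0 // => i.
rewrite -val_eqE /= => ikn; case: eqP => // E.
by rewrite E eqxx in ikn.
Qed.

End simplicial_sums.

(** * Euler characteristic on the grid *)

Section grid_euler.
Context {R : realType} (d : nat).
Implicit Types (a eps : R) (N : nat) (omega s : {fset euclid R d}).

(** An infimum is below [eps] as soon as one shift is, and for the sup norm the shift can be chosen
    separately in each coordinate. *)
Lemma torus_ballE a eps (v y : euclid R d) : 0 < eps ->
  torus_ball a v eps y <->
  torus a y /\ forall i, circle_near a eps (tnth v i) (tnth y i).
Proof.
move=> eps0; split=> -[ty H]; split=> //; last first.
  have [m Hm] := fin_all_exists (fun i => asboolP _ (H i)).
  apply: (@le_lt_trans _ _
    `| \row_(i < d) ((tnth v i : R) - tnth y i + (m i)%:~R * a) |).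
    apply: ge_inf; last by exists m.
    by exists 0 => _ [n _ <-].
  rewrite /Num.norm /= mx_normrE; apply/bigmax_ltP; split=> // -[i j] _ /=.
  by rewrite mxE.
move: H; rewrite /torus_dist => /inf_lt[].
  by exists `| \row_(i < d) ((tnth v i : R) - tnth y i + (0 : int)%:~R * a) |,
    (fun=> 0).
move=> _ [m _ <-] Hm i; apply/asboolP; exists (m i).
move: Hm; rewrite /Num.norm /= mx_normrE => /bigmax_ltP[_ /(_ (ord0, i) isT)] /=.
by rewrite mxE.
Qed.

(** Balls of the sup norm are products of arcs, so a common point is assembled coordinate by
    coordinate. *)
Lemma cech_inter a eps s : 0 < eps -> s != fset0 ->
  `[< \bigcap_(v in [set` s]) torus_ball a v eps !=set0 >] =
  [forall i : 'I_d, `[< exists2 y : R, 0 <= y < a &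
     forall v : s, circle_near a eps (tnth (val v) i) y >]].
Proof.
move=> eps0 /fset0Pn[v0 v0s]; apply/asboolP/forallP => [[y sy] i|H].
  apply/asboolP; exists (tnth y i).
    by have /torus_ballE[] := sy v0 v0s; last by move=> + _; exact.
  by move=> v; have /torus_ballE[] // := sy (val v) (valP v); move=> _; exact.
have /fin_all_exists[y Hy] : forall i : 'I_d, exists y : R, 0 <= y < a /\
    forall v : s, circle_near a eps (tnth (val v) i) y.
  by move=> i; have /asboolP[y ya sy] := H i; exists y.
exists ([tuple y i | i < d] : euclid R d) => v vs; apply/torus_ballE => //.
split=> i; rewrite tnth_mktuple; first exact: (Hy i).1.
exact: ((Hy i).2 [` vs]%fset).
Qed.

Definition grid_box a eps N (f : {ffun 'I_d -> 'I_N * bool}) : set (euclid R d) :=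
  [set x | forall i, 0 <= (tnth x i : R) < a /\ grid_arc a eps (f i) (tnth x i)].

Definition grid_euler a eps N omega : R :=
  \sum_(f : {ffun 'I_d -> 'I_N * bool})
    (\prod_i (-1) ^+ (f i).2) * (0 < num_points (grid_box a eps f) omega)%N%:R.

Definition grid_meets a eps N s : bool :=
  [forall i : 'I_d, exists k : 'I_N,
    `[< forall v : s, circle_near a eps (tnth (val v) i) (k%:R * (a / N%:R)) >]].

(** Expand each hit indicator by [sum_sign_simplices] and exchange the sums. For a fixed simplex the
    sum over boxes factors over the coordinates, and [sum_grid_arc] evaluates each factor. *)
Lemma grid_euler_simplices a eps N omega :
  0 < eps -> eps < a / 4 -> (0 < N)%N -> a / N%:R < 2 * eps ->
  (forall x, x \in omega -> torus a x) ->
  grid_euler a eps N omega =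
  \sum_(s <- fpowerset omega | s != fset0)
    (-1) ^+ (#|` s|.-1) * (grid_meets a eps N s)%:R.
Proof.
move=> eps0 epsa N0 hN ota; rewrite /grid_euler.
under eq_bigr => f _ do rewrite -sum_sign_simplices mulr_sumr.
rewrite exchange_big /=; apply: eq_fbigr => s; rewrite fpowersetE => so s0.
under eq_bigr => f _ do rewrite mulrCA.
rewrite -mulr_sumr; congr (_ * _).
have [v0 v0s] := fset0Pn _ s0.
pose S i : set R := [set (tnth v i : R) | v in [set` s]].
transitivity (\sum_(f : {ffun 'I_d -> 'I_N * bool}) \prod_i ((-1) ^+ (f i).2 *
    (`[< S i `<=` grid_arc a eps (f i) >])%:R) : R).
  apply: eq_bigr => f _; rewrite big_split /=; congr (_ * _).
  rewrite prod_indicator; congr ((nat_of_bool _)%:R); apply/asboolP/forallP => /= H.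
    move=> i; apply/asboolP => _ [v vs <-]; exact: (H v vs i).2.
  move=> v vs i; split; last by have /asboolP := H i; apply; exists v.
  by apply: ota; exact: (fsubsetP so).
rewrite -(bigA_distr_bigA (fun i (p : 'I_N * bool) => (-1) ^+ p.2 *
  (`[< S i `<=` grid_arc a eps p >])%:R)) /=.
under eq_bigr => i _.
  rewrite (sum_grid_arc eps0 epsa N0 hN); last by exists (tnth v0 i), v0.
  over.
rewrite prod_indicator; congr ((nat_of_bool _)%:R); apply: eq_forallb => i.
apply: eq_existsb => k; apply: asbool_equiv_eq; split=> [Sk v|Sk _ [v vs <-]].
  by apply: Sk; exists (val v) => //; exact: valP.
exact: (Sk [` vs]%fset).
Qed.

(** Each subset of [omega] contributes at most 1 in absolute value. The bound is free of [N], as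
    domination requires. *)
Lemma norm_grid_euler_le a eps N omega :
  0 < eps -> eps < a / 4 -> (0 < N)%N -> a / N%:R < 2 * eps ->
  (forall x, x \in omega -> torus a x) ->
  `|grid_euler a eps N omega| <= 2 ^+ #|` omega|.
Proof.
move=> eps0 epsa N0 hN ota; rewrite grid_euler_simplices //.
rewrite (le_trans (ler_norm_sum _ _ _)) //.
apply: (@le_trans _ _ (\sum_(s <- fpowerset omega) 1%:R)).
  rewrite big_mkcond; apply: ler_sum => s _; case: ifP => // _.
  rewrite normrM normrX normrN1 expr1n mul1r.
  by case: grid_meets; rewrite ?normr1 ?normr0.
by rewrite -natr_sum -card_fset_sum1 card_fpowerset natrX.
Qed.

Lemma euler_char_simplices a eps omega :
  (euler_char a eps omega)%:~R =
  \sum_(s <- fpowerset omega | s != fset0) (-1) ^+ (#|` s|.-1) *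
    (`[< \bigcap_(v in [set` s]) torus_ball a v eps !=set0 >])%:R :> R.
Proof.
rewrite /euler_char rmorph_sum /=.
under eq_bigr do rewrite rmorphM rmorphXn rmorphN1 /= -pmulrn.
rewrite sum_simplices_by_dim.
  under [RHS]eq_bigr do rewrite mulr_natr mulrb.
  by rewrite -big_mkcondr /= -big_fset_condE.
move=> s; rewrite /cech !inE fpowersetE => /andP[so /andP[s0 _]].
by rewrite cardfs_gt0 s0 fsubset_leq_card.
Qed.

(** Nearness is an open condition, so a common point can be moved to a fine grid. Conversely, grid
    points lie in [[0, a)] and are themselves admissible common coordinates. *)
Lemma near_grid_meets a eps s : 0 < a -> 0 < eps -> s != fset0 ->
  \forall N \near \oo, grid_meets a eps N s =
    `[< \bigcap_(v in [set` s]) torus_ball a v eps !=set0 >].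
Proof.
move=> a0 eps0 s0; rewrite cech_inter //.
case: (boolP [forall i : 'I_d, _]) => [/forallP H|/forallPn[i /asboolPn H]].
  have : \forall N \near \oo, forall i : 'I_d, exists k : 'I_N,
      forall v : s, circle_near a eps (tnth (val v) i) (k%:R * (a / N%:R)).
    apply: filter_forall => i; have /asboolP[y ya sy] := H i.
    exact: near_exists_grid ya sy.
  apply: filterS => N HN; apply/forallP => i; apply/existsP.
  by have [k Hk] := HN i; exists k; apply/asboolP.
near=> N; apply/negbTE/forallPn; exists i; apply/existsPn => k.
apply/asboolPn => Hk; apply: H; exists (k%:R * (a / N%:R)) => //.
have N0 : 0 < N%:R :> R by rewrite ltr0n; near: N; exact: nbhs_infty_gt.
apply/andP; split; first by rewrite mulr_ge0 // divr_ge0 ?ltW.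
by rewrite mulrA ltr_pdivrMr // mulrC ltr_pM2l // ltr_nat.
Unshelve. all: by end_near. Qed.

Lemma near_grid_euler a eps omega : 0 < eps -> eps < a / 4 ->
  (forall x, x \in omega -> torus a x) ->
  \forall N \near \oo, grid_euler a eps N omega = (euler_char a eps omega)%:~R.
Proof.
move=> eps0 epsa ota; have a0 : 0 < a by lra.
near=> N.
have N0' : (0 < N)%N by near: N; exact: nbhs_infty_gt.
have hN : a / N%:R < 2 * eps.
  rewrite ltr_pdivrMr ?ltr0n // mulrC -ltr_pdivrMr ?mulr_gt0 //.
  by near: N; exact: nbhs_infty_gtr.
rewrite grid_euler_simplices // euler_char_simplices.
(* A configuration has finitely many subsets, so one threshold on [N], depending on [omega], serves
   them all. *)
have H : forall s : fpowerset omega, val s != fset0 -> grid_meets a eps N (val s) =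
    `[< \bigcap_(v in [set` val s]) torus_ball a v eps !=set0 >].
  near: N; apply: filter_forall => s.
  have [s0|s0] := boolP (val s != fset0); last by apply: nearW => N.
  by apply: filterS (near_grid_meets a0 eps0 s0) => N + _.
apply: eq_fbigr => s sp s0; congr (_ * (nat_of_bool _)%:R).
exact: (H [` sp]%fset s0).
Unshelve. all: by end_near. Qed.

End grid_euler.

(** * Poisson processes *)

Section poisson.
Context {R : realType}.

Lemma poisson_prob_gt0 (r : R) : 0 < r ->
  poisson_prob r 0 [set k | (0 < k)%N] = (1 - expR (- r))%:E.
Proof.
move=> r0; have -> : [set k | (0 < k)%N] = ~` [set 0%N].
  by apply/seteqP; split=> k /=; [move=> /lt0n_neq0/eqP|move=> /eqP; rewrite lt0n].
rewrite probability_setC //= /poisson_prob r0 esum_set1 ?lee_fin ?poisson_pmf_ge0 //.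
by rewrite /poisson_pmf r0 expr0 fact0 invr1 !mul1r.
Qed.

(** Each term is [expR r] times the Poisson weight of mean [2 * r], and these weights sum to 1. *)
Lemma nneseries_expn_poisson_pmf (r : R) : 0 < r ->
  (\sum_(k <oo) (2 ^+ k * poisson_pmf r k)%:E = (expR r)%:E)%E.
Proof.
move=> r0; have r20 : 0 < 2 * r by rewrite mulr_gt0.
have E k : (2 ^+ k * poisson_pmf r k)%:E = ((expR r)%:E * (poisson_pmf (2 * r) k)%:E)%E.
  rewrite -EFinM /poisson_pmf r0 r20 exprMn.
  have -> : expR (- r) = expR r * expR (- (2 * r)).
    by rewrite -expRD; congr expR; ring.
  by congr (_%:E); ring.
under eq_eseriesr => k _ do rewrite E.
rewrite nneseriesZl; last by move=> k _; rewrite lee_fin poisson_pmf_ge0.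
have := probability_setT (poisson_prob (2 * r) 0); rewrite /= /poisson_prob r20.
rewrite -nneseries_esumT; last by move=> *; rewrite lee_fin poisson_pmf_ge0.
by move=> ->; rewrite mule1.
Qed.

Context {disp : measure_display} {T : measurableType disp} (P : probability T R).

Lemma integrable_expn_poisson (r : R) (M : T -> nat) : 0 < r ->
  measurable_fun [set: T] M ->
  (forall B : set nat, P [set t | B (M t)] = poisson_prob r 0 B) ->
  P.-integrable [set: T] (fun t => (2 ^+ M t)%:E).
Proof.
move=> r0 mM PM.
have mg : measurable_fun [set: T] (EFin \o (fun t => 2 ^+ M t : R)).
  by apply: (measurableT_comp (f := EFin \o (fun k : nat => 2 ^+ k : R))).
apply/integrableP; split=> //.
have mF k : measurable (M @^-1` [set k]).
  by rewrite -[X in measurable X]setTI; exact: mM.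
have TE : \bigcup_k (M @^-1` [set k]) = [set: T].
  by apply/seteqP; split=> // t _; exists (M t).
under eq_integral do rewrite gee0_abs ?lee_fin ?exprn_ge0 //.
have tF : trivIset [set: nat] (fun k => M @^-1` [set k]).
  apply/trivIsetP => i j _ _ ij; apply/seteqP; split=> // t [/= Mi Mj].
  by move: ij; rewrite -Mi -Mj eqxx.
rewrite -TE ge0_integral_bigcup //; last by rewrite TE.
rewrite (eq_eseriesr (g := fun k => (2 ^+ k * poisson_pmf r k)%:E)).
  by rewrite nneseries_expn_poisson_pmf // ltry.
move=> k _; rewrite (eq_integral (cst (2 ^+ k)%:E)); last first.
  by move=> t /set_mem /= ->.
transitivity ((2 ^+ k)%:E * P (M @^-1` [set k]))%E; first exact: integral_cst.
have -> : P (M @^-1` [set k]) = poisson_prob r 0 [set k] := PM [set k].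
rewrite /poisson_prob r0 esum_set1 -?EFinM //.
by rewrite lee_fin poisson_pmf_ge0.
Qed.

End poisson.

(** * Expectation of the grid sums and passage to the limit *)

Section grid_euler_process.
Context {R : realType} {disp : measure_display} {T : measurableType disp}.
Variables (d : nat) (a lambda eps : R) (P : probability T R).
Variable (omega : T -> {fset euclid R d}).
Hypotheses (hd : (1 <= d)%N) (lambda0 : 0 < lambda).
Hypotheses (eps0 : 0 < eps) (epsa : eps < a / 4).
Hypothesis (homega : poisson_process P a lambda omega).

Let a0 : 0 < a. Proof. by have ? := eps0; have ? := epsa; lra. Qed.

Section grid.
Variable N : nat.
Hypotheses (N0 : (0 < N)%N) (hN : a / N%:R < 2 * eps).

Let len := grid_arc_length a eps N.

Let len0 b : 0 < len b.
Proof.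
by have ? := eps0; have ? := hN; rewrite /len /grid_arc_length; case: b; lra.
Qed.

Let box_measurable (f : {ffun 'I_d -> 'I_N * bool}) : measurable (grid_box a eps f).
Proof.
exact: (measurable_box (fun i => (grid_arc_measure (f i) eps0 epsa hN).1)).
Qed.

Let box_torus (f : {ffun 'I_d -> 'I_N * bool}) : grid_box a eps f `<=` torus a.
Proof. by move=> x H i; exact: (H i).1. Qed.

Let hit (f : {ffun 'I_d -> 'I_N * bool}) : set T :=
  [set t | (0 < num_points (grid_box a eps f) (omega t))%N].

Let hit_measurable f : measurable (hit f).
Proof.
have := poisson_process_measurable homega (box_measurable f) (@box_torus f).
move=> /(_ measurableT [set k | (0 < k)%N] I).
by rewrite setTI.
Qed.

Let prob_hit f :
  P (hit f) = (1 - expR (- (lambda * \prod_i len (f i).2)))%:E.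
Proof.
rewrite (poisson_process_law homega (box_measurable f) (@box_torus f)
  [set k | (0 < k)%N]).
rewrite (lebesgue_box (fun i => (grid_arc_measure (f i) eps0 epsa hN).1)
  (fun i => (grid_arc_measure (f i) eps0 epsa hN).2)) /=.
by rewrite poisson_prob_gt0 // mulr_gt0 // prodr_gt0.
Qed.

Let grid_eulerE t : (grid_euler a eps N (omega t))%:E =
  (\sum_(f : {ffun 'I_d -> 'I_N * bool})
    (\prod_i (-1) ^+ (f i).2)%:E * (\1_(hit f) t)%:E)%E.
Proof.
rewrite /grid_euler -sumEFin; apply: eq_bigr => f _; rewrite EFinM.
congr (_ * _)%E; rewrite indicE; congr ((nat_of_bool _)%:R%:E).
by apply/idP/idP => [?|/set_mem //]; exact: mem_set.
Qed.

Lemma measurable_grid_euler :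
  measurable_fun [set: T] (EFin \o (fun t => grid_euler a eps N (omega t))).
Proof.
rewrite (funext grid_eulerE : EFin \o _ = _).
apply: emeasurable_sum => f; apply: measurable_funeM.
by apply/measurable_EFinP; exact: measurable_indic.
Qed.

(** The point [p] comes from [mixed_difference_MVT] at [t = 1] with [c = N]: the number of grid
    points times the difference of the two lengths is [a]. *)
Lemma integral_grid_euler :
  exists2 p : R, (2 * eps - a / N%:R) ^+ d <= p <= (2 * eps) ^+ d &
  (\int[P]_t (grid_euler a eps N (omega t))%:E)%E =
  (- (a ^+ d * (bell_poly d (- (lambda * p)) * expR (- (lambda * p))) / p))%:E.
Proof.
pose psi k t := bell_poly k (- (lambda * t)) * expR (- (lambda * t)).
have dpsi k (t : R) : 0 < t -> is_derive t 1 (psi k) (psi k.+1 t / t).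
  exact: is_derive_bell_exp.
have uv : 0 < 2 * eps - a / N%:R < 2 * eps.
  by rewrite subr_gt0 hN ltrBlDr ltrDl divr_gt0 // ltr0n.
have [p Hp E] := mixed_difference_MVT d N%:R uv dpsi ltr01.
exists p => //.
under eq_integral do rewrite grid_eulerE.
rewrite integral_sum //; last first.
  by move=> f; apply: integrableZl => //; exact: integrable_indic.
transitivity (\sum_(f : {ffun 'I_d -> 'I_N * bool}) ((\prod_i (-1) ^+ (f i).2) *
    (1 - expR (- (lambda * \prod_i len (f i).2))))%:E)%E.
  apply: eq_bigr => f _; rewrite integralZl //; last exact: integrable_indic.
  by rewrite integral_indic // setIT EFinM -prob_hit.
rewrite sumEFin; congr (_%:E).
under eq_bigr do rewrite mulrBr mulr1.
rewrite sumrB -(bigA_distr_bigA (fun (i : 'I_d) (q : 'I_N * bool) => (-1) ^+ q.2)) /=.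
have sum0 (F : bool -> R) : \sum_(q : 'I_N * bool) (-1) ^+ q.2 * F q.2 =
    N%:R * (F false - F true).
  rewrite -(pair_bigA _ (fun (k : 'I_N) (b : bool) => (-1) ^+ b * F b)) /=.
  rewrite sumr_const card_ord big_bool /= expr1 expr0 mul1r mulN1r mulr_natl.
  by rewrite addrC.
have sign0 : \sum_(q : 'I_N * bool) (-1) ^+ q.2 = 0 :> R.
  transitivity (\sum_(q : 'I_N * bool) (-1) ^+ q.2 * 1 : R).
    by apply: eq_bigr => q _; rewrite mulr1.
  by rewrite (sum0 (fun=> 1)) subrr mulr0.
(* The constants 1 in the hitting probabilities cancel because the signs sum to 0 in each
   coordinate; [hd] rules out the empty product. *)
rewrite prodr_const card_ord sign0 expr0n eqn0Ngt hd sub0r; congr (- _).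
have psi0 t : expR (- (lambda * t)) = psi 0%N t by rewrite /psi bell_poly0 mul1r.
under eq_bigr do rewrite psi0 -[X in psi _ X]mul1r.
rewrite (sum_ffun_prod_iter (fun q : 'I_N * bool => (-1) ^+ q.2) (fun q => len q.2)).
move: E; rewrite mul1r subKr.
have -> : N%:R * (a / N%:R) = a by rewrite mulrC divfK // pnatr_eq0 -lt0n.
move=> <-; congr (iter _ _ _ _); apply/funext => phi; apply/funext => s.
by rewrite (sum0 (fun b => phi (s * len b))) /len /grid_arc_length subr0.
Qed.

End grid.

Let card_omega t : #|` omega t| = num_points (torus a) (omega t).
Proof.
congr #|` _|; apply/fsetP => x; rewrite !inE /=.
have [xo|//] := boolP (x \in omega t).
by rewrite mem_set //; exact: (poisson_process_torus homega xo).
Qed.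

Let torus_box : @torus R a d = [set x | forall i, `[0, a[%classic (tnth x i)].
Proof. by apply/seteqP; split=> x H i; have := H i; rewrite /= in_itv. Qed.

Lemma integrable_expn_card :
  P.-integrable [set: T] (fun t => (2 ^+ #|` omega t|)%:E).
Proof.
have mtorus : measurable (@torus R a d).
  rewrite torus_box; apply: (measurable_box (A := fun=> `[0, a[%classic)) => i.
  exact: measurable_itv.
have torusE : lebesgue (@torus R a d) = (a ^+ d)%:E.
  rewrite torus_box (lebesgue_box (A := fun=> `[0, a[%classic)
    (m := fun=> a)) => [|i|i].
  - by rewrite prodr_const card_ord.
  - exact: measurable_itv.
  - by rewrite lebesgue_measure_itv /= lte_fin a0 oppr0 adde0.
under eq_fun do rewrite card_omega.
apply: (@integrable_expn_poisson _ _ _ _ (lambda * a ^+ d)).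
- by rewrite mulr_gt0 // exprn_gt0.
- exact: (poisson_process_measurable homega).
- move=> B; rewrite (poisson_process_law homega) //.
  by rewrite torusE.
Qed.

Lemma euler_char_expectation :
  let chi : T -> R := fun t => (euler_char a eps (omega t))%:~R in
  P.-integrable [set: T] (EFin \o chi) /\
  (\int[P]_t (chi t)%:E)%E =
    (- (a ^+ d * (bell_poly d (- (lambda * (2 * eps) ^+ d)) *
       expR (- (lambda * (2 * eps) ^+ d))) / (2 * eps) ^+ d))%:E.
Proof.
move=> chi; have e20 : 0 < 2 * eps by rewrite mulr_gt0.
(* Starting the sequence of grids at [M] makes every grid step smaller than [2 * eps]. *)
pose M := (Num.truncn (a / (2 * eps))).+1.
have N0 n : (0 < n + M)%N by rewrite addnS.
have hN n : a / (n + M)%:R < 2 * eps.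
  rewrite ltr_pdivrMr ?ltr0n // mulrC -ltr_pdivrMr //.
  by rewrite (lt_le_trans (truncnS_gt _)) // ler_nat leq_addl.
have ota t x : x \in omega t -> torus a x by exact: (poisson_process_torus homega).
pose X n t := (grid_euler a eps (n + M) (omega t))%:E.
have Xchi t : X ^~ t @ \oo --> (chi t)%:E.
  apply: cvg_near_cst.
  have H := @cvg_addnr M _ (near_grid_euler eps0 epsa (ota t)).
  by move: H => [k kt Hk]; exists k => //= n kn; rewrite /X (Hk n kn).
have mX n : measurable_fun [set: T] (X n) by exact: measurable_grid_euler.
(* The Euler characteristic is measurable as a pointwise limit of finite signed sums of
   indicators. *)
have mchi : measurable_fun [set: T] (EFin \o chi).
  exact: (emeasurable_fun_cvg X (EFin \o chi) mX (fun t _ => Xchi t)).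
have [] := @dominated_convergence _ T R P [set: T] measurableT X (EFin \o chi)
  (fun t => (2 ^+ #|` omega t|)%:E) mX mchi.
- by apply: aeW => t _; exact: Xchi.
- exact: integrable_expn_card.
- by apply: aeW => t n _; rewrite lee_fin;
    exact: (norm_grid_euler_le eps0 epsa (N0 n) (hN n) (ota t)).
move=> ichi _ intX; split=> //.
have /choice[p Hp] n : exists p : R,
    (2 * eps - a / (n + M)%:R) ^+ d <= p <= (2 * eps) ^+ d /\
    (\int[P]_t X n t)%E =
    (- (a ^+ d * (bell_poly d (- (lambda * p)) * expR (- (lambda * p))) / p))%:E.
  by have [p Hp E] := integral_grid_euler (N0 n) (hN n); exists p.
(* Dominated convergence identifies the integral of [chi] as a limit; that limit is now computed
   from the exact values. *)
apply: (cvg_unique _ intX) => //.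
pose g s := bell_poly d (- (lambda * s)) * expR (- (lambda * s)).
rewrite (_ : [sequence _]_n =
  EFin \o (fun n => - (a ^+ d * g (p n) / p n))); last first.
  by apply/funext => n; exact: (Hp n).2.
apply: cvg_EFin; first by apply: nearW.
(* The intermediate points are not explicit, but they are squeezed between bounds with the same
   limit. *)
have pu : p @ \oo --> (2 * eps) ^+ d.
  apply: (@squeeze_cvgr _ _ _ _
    (fun n => (2 * eps - a / (n + M)%:R) ^+ d) (fun=> (2 * eps) ^+ d)).
  - by apply: nearW => n; exact: (Hp n).1.
  - apply: (@continuous_cvg _ _ _ _ _ _ (fun x : R => x ^+ d)).
      exact: exprn_continuous.
    rewrite -[X in _ --> X]subr0; apply: cvgB; first exact: cvg_cst.
    rewrite -(mulr0 a); apply: cvgM; first exact: cvg_cst.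
    rewrite (_ : (fun n => _) = harmonic \o addn^~ (Num.truncn (a / (2 * eps)))).
      by apply: cvg_comp; [exact: cvg_addnr|exact: cvg_harmonic].
    by apply/funext => n; rewrite /M /harmonic /= addnS.
  - exact: cvg_cst.
have u0 : 0 < (2 * eps) ^+ d by rewrite exprn_gt0.
have gu : g (p n) @[n --> \oo] --> g ((2 * eps) ^+ d).
  apply: continuous_cvg pu.
  apply/differentiable_continuous/derivable1_diffP.
  by have [] := is_derive_bell_exp lambda d u0.
apply: cvgN; apply: cvgM; first by apply: cvgM => //; exact: cvg_cst.
by apply: cvgV => //; rewrite gt_eqF.
Qed.

End grid_euler_process.

Theorem theorem11 (R : realType) (d : nat) (a lambda eps : R)
    (hd : (1 <= d)%N) (ha : 0 < a) (hlambda : 0 < lambda)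
    (heps0 : 0 < eps) (heps : eps < a / 4)
    (disp : measure_display) (T : measurableType disp) (P : probability T R)
    (omega : T -> {fset euclid R d})
    (homega : poisson_process P a lambda omega) :
  let chi : T -> R := fun t => (euler_char a eps (omega t))%:~R in
  P.-integrable [set: T] (EFin \o chi) /\
  'E_P[chi]%E =
    (- ((a / (2 * eps)) ^+ d) * expR (- (lambda * (2 * eps) ^+ d)) *
       bell_poly d (- (lambda * (2 * eps) ^+ d)))%:E.
Proof.
move=> chi; have [ichi Echi] := euler_char_expectation hd hlambda heps0 heps homega.
split; first exact: ichi.
rewrite unlock Echi; congr (_%:E); rewrite !expr_div_n exprMn.
by field; rewrite !expf_neq0 // gt_eqF.
Qed.
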